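(* Let $X$ be a Banach space and let $(A_m)_{m\in\mathbb Z}$ be a sequence of bounded invertible linear operators on $X$ that admits an exponential dichotomy on $\mathbb Z$ and satisfies $\sup_{m\in\mathbb Z}\|A_m^{-1}\|<\infty$. Let $L>0$ be a constant such that the linear system $x_{n+1}=A_nx_n$, $n\in\mathbb Z$, has the $l^\infty$-Lipschitz shadowing property with $\delta=L\varepsilon$ (for each $\varepsilon>0$). Then for all sufficiently small $\varepsilon>0$ and all sufficiently small $c>0$ (i.e. there are $\varepsilon_0,c_0>0$ such that the following holds for all $0<\varepsilon<\varepsilon_0$ and $0<c<c_0$): if $\delta=L\varepsilon$ and $g_n\colon X\to X$, $n\in\mathbb Z$, are maps satisfying $$\|g_n(x)-g_n(y)\|\le c\|x-y\|\quad\text{and}\quad \|g_n\|_{\sup}:=\sup_{x\in X}\|g_n(x)\|\le\delta$$ for all $n\in\mathbb Z$ and $x,y\in X$, and $G_n:=A_n+g_n$, then there exists a unique sequence $h_m\colon X\to X$, $m\in\mathbb Z$, of homeomorphisms such that for each $m\in\mathbb Z$, $$h_{m+1}\circ G_m=A_m\circ h_m\qquad\text{and}\qquad \sup_{x\in X}\|h_m(x)-x\|\le\varepsilon.$$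
   Context: **Exponential dichotomy on $\mathbb Z$.** For $m\ge n$ set $\mathcal A(m,n)=A_{m-1}\cdots A_n$ if $m>n$ and $\mathcal A(m,m)=\mathrm{Id}$. The sequence $(A_m)_{m\in\mathbb Z}$ admits an exponential dichotomy if: (1) there are projections $P_m$, $m\in\mathbb Z$, on $X$ with $P_{m+1}A_m=A_mP_m$ for all $m$; (2) $A_m|_{\ker P_m}\colon\ker P_m\to\ker P_{m+1}$ is invertible for all $m$; (3) there exist $C,\lambda>0$ such that $\|\mathcal A(m,n)P_n\|\le Ce^{-\lambda(m-n)}$ for $m\ge n$ and $\|\mathcal A(m,n)(\mathrm{Id}-P_n)\|\le Ce^{-\lambda(n-m)}$ for $m\le n$, where for $m\le n$, $\mathcal A(m,n):=(\mathcal A(n,m)|_{\ker P_m})^{-1}\colon\ker P_n\to\ker P_m$. **$l^\infty$-Lipschitz shadowing.** The system $x_{n+1}=A_nx_n$, $n\in\mathbb Z$, has the $l^\infty$-Lipschitz shadowing property with constant $L>0$ if for every $\varepsilon>0$ and every sequence $(y_n)_{n\in\mathbb Z}\subset X$ with $\sup_{n\in\mathbb Z}\|y_{n+1}-A_ny_n\|\le L\varepsilon$ there is a sequence $(x_n)_{n\in\mathbb Z}\subset X$ with $x_{n+1}=A_nx_n$ for all $n\in\mathbb Z$ and $\sup_{n\in\mathbb Z}\|x_n-y_n\|\le\varepsilon$. (Under an exponential dichotomy on $\mathbb Z$ such an $L$ always exists.) *)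

(* Defs.v *)
From HB Require Import structures.
From mathcomp Require Import all_boot all_order all_algebra.
From mathcomp Require Import all_classical all_reals all_analysis.
Set Implicit Arguments.
Unset Strict Implicit.
Unset Printing Implicit Defensive.
Import Order.TTheory GRing.Theory Num.Theory.
Import numFieldNormedType.Exports.
Local Open Scope classical_set_scope.
Local Open Scope ring_scope.

(* Suprema of norms are taken in the extended reals,
   so that "supremum <= r" and "supremum < +oo" need no a priori boundedness. *)

Definition supnorm (R : realType) (X : normedModType R) (T : Type)
  (f : T -> X) : \bar R := ereal_sup (range (fun t => `|f t|%:E)).

(* Only meaningful as an operator norm when f is linear. The argument is a bare
   function because the backward cocycle below is not bundled as a linear map. *)
Definition opnorm (R : realType) (X : normedModType R) (f : X -> X) : \bar R :=
  ereal_sup [set `|f x|%:E | x in [set x : X | `|x| <= 1]].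

Definition homeomorphism (S T : topologicalType) (h : S -> T) : Prop :=
  continuous h /\
  exists k : T -> S, [/\ cancel h k, cancel k h & continuous k].

(* iter_op A n k = A_(n + k - 1) o ... o A_n *)
Fixpoint iter_op (X : Type) (A : int -> X -> X) (n : int) (k : nat) (x : X) : X :=
  if k is k'.+1 then A (n + k'%:Z) (iter_op A n k' x) else x.

(* A(m, n); to be used for n <= m only, since `|m - n| is an absolute value. *)
Definition cocycle (X : Type) (A : int -> X -> X) (m n : int) : X -> X :=
  iter_op A n `|m - n|%N.

Definition lker_set (R : realType) (X : normedModType R) (P : X -> X) : set X :=
  [set x | P x = 0].

(* A(m, n) for m <= n: the inverse of A(n, m) : ker P_m -> ker P_n. Off the
   image A(n, m)(ker P_m) it takes unspecified values. *)
Definition back_cocycle (R : realType) (X : normedModType R)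
  (A P : int -> X -> X) (m n : int) : X -> X :=
  'pinv_(fun=> 0) (lker_set (P m)) (cocycle A n m).

(* The P_m are not assumed bounded: this follows from the first bound at
   m = n. *)
Definition exp_dichotomy (R : realType) (X : normedModType R)
  (A : int -> {linear X -> X}) : Prop :=
  exists (P : int -> {linear X -> X}) (C lambda : R),
    [/\ (forall m x, P m (P m x) = P m x),
        (forall m x, P (m + 1) (A m x) = A m (P m x)),
        (forall m, set_bij (lker_set (P m)) (lker_set (P (m + 1))) (A m)) &
        [/\ 0 < C, 0 < lambda,
            (forall m n : int, n <= m ->
               (opnorm (fun x => cocycle A m n (P n x))
                 <= (C * expR (- lambda * (m - n)%:~R))%:E)%E) &
            (forall m n : int, m <= n ->
               (opnorm (fun x => back_cocycle A P m n (x - P n x)%R)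
                 <= (C * expR (- lambda * (n - m)%:~R))%:E)%E)]].

Definition lipschitz_shadowing (R : realType) (X : normedModType R)
  (A : int -> X -> X) (L : R) : Prop :=
  forall (eps : R) (y : int -> X), 0 < eps ->
    (supnorm (fun n => (y (n + 1) - A n (y n))%R) <= (L * eps)%:E)%E ->
    exists x : int -> X,
      (forall n, x (n + 1) = A n (x n)) /\
      (supnorm (fun n => (x n - y n)%R) <= eps%:E)%E.

(* Main.v *)
Require Import Defs.
From HB Require Import structures.
From mathcomp Require Import all_boot all_order all_algebra.
From mathcomp Require Import all_classical all_reals all_analysis.
From mathcomp Require Import ring lra zify.
Set Implicit Arguments.
Unset Strict Implicit.
Unset Printing Implicit Defensive.
Import Order.TTheory GRing.Theory Num.Theory.
Import numFieldNormedType.Exports.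
Local Open Scope classical_set_scope.
Local Open Scope ring_scope.

(** The maps [h m] and their inverses are two instances of one construction.
Fix two perturbations [g] and [g'] of the linear system, both [c]-Lipschitz, and
look for a map [H n], close to the identity, sending orbits of [A + g] to orbits
of [A + g'].  The difference [z = y' - y] of the image orbit and the original
one solves the linear equation [z (n + 1) = A n (z n) + f n] forced by
[f n = g' n (y n + z n) - g n (y n)].

Existence.  Shadowing says exactly that a forcing bounded by [L * e] has a
solution bounded by [e]: shadow any solution of the forced equation and take the
difference ([bounded_forced_solution]).  So bounded forcing is turned into
bounded solutions with norm at most [1 / L], and since [z |-> f] is
[c]-Lipschitz the equation for [z] is a fixed point problem with contraction
factor [c / L] ([perturb_orbit_shadow]).  For a forcing of size [L * e] the
fixed point has size at most [e], which is the closeness that the theorem asks.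

Uniqueness and continuity.  The dichotomy, used on a window of [N] steps on
both sides of a time [m], bounds a solution at [m] by a multiple of [r ^+ N] times
its global bound, plus a multiple of the forcing on the window ([window_estimate]).
Suppose a uniformly bounded family of solutions has forcing at most [c] times the
solution, up to an error that tends to [0] at every fixed time.  Applying the
estimate repeatedly, the bound on the solutions is halved each time, so they tend
to [0] at every fixed time ([forced_solution_vanishing]).  For a single solution
this says that two orbits of [A + g'] at bounded distance coincide
([perturb_orbit_unique]), hence that near-identity semiconjugacies are unique.
Applied to the displacements [z] of the orbits of nearby points, of which it
compares two at a time, it says that [H n] is continuous ([near_id_semiconj_exists]).

Conclusion.  The semiconjugacies from [A + g] to [A] and from [A] to [A + g]
compose, in both orders, to near-identity semiconjugacies of a system with
itself; by uniqueness these are the identity, so both maps are homeomorphisms.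
To speak of two-sided orbits of [A + g] this map has to be inverted; this is
again a contraction argument, for [c] small against the norms of the inverses of
the [A n] ([perturb_inverse]). *)

(** * Two-sided orbits of invertible sequences of maps *)
Section Evolution.
Variables (T : Type) (F Finv : int -> T -> T).

Definition is_orbit (o : int -> T) : Prop := forall n, o (n + 1) = F n (o n).

Fixpoint iter_inv (m : int) (k : nat) (x : T) : T :=
  if k is k'.+1 then Finv (m - k'.+1%:Z) (iter_inv m k' x) else x.

(** The value at time [n] of the orbit that is at [x] at time [m].  Working with one
family of maps for both directions of time makes the cocycle identity hold for
all triples of times. *)
Definition evolution (n m : int) (x : T) : T :=
  match n - m with
  | Posz k => iter_op F m k x
  | Negz k => iter_inv m k.+1 x
  end.

Hypothesis FK : forall n, cancel (F n) (Finv n).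
Hypothesis KF : forall n, cancel (Finv n) (F n).

Lemma int_bidirectional_ind (Q : int -> Prop) (m : int) :
  Q m -> (forall n, Q n -> Q (n + 1)) -> (forall n, Q (n + 1) -> Q n) ->
  forall n, Q n.
Proof.
move=> Qm up down n; rewrite -(subrK m n) addrC.
elim/int_rec: (n - m) => [|k IH|k IH]; first by rewrite addr0.
- by rewrite -addn1 PoszD addrA; apply: up.
- by apply: down; rewrite -addn1 PoszD opprD addrA subrK.
Qed.

Lemma evolution_id m x : evolution m m x = x.
Proof. by rewrite /evolution subrr. Qed.

Lemma evolution_orbit m x : is_orbit (fun n => evolution n m x).
Proof.
move=> n; rewrite /evolution.
case E : (n - m) => [k|[|k]].
- have -> : n + 1 - m = Posz k.+1 by lia.
  by rewrite /=; congr (F _ _); lia.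
- have -> : n + 1 - m = Posz 0 by lia.
  have -> : n = m - 1 by lia.
  by rewrite /= KF.
- have -> : n + 1 - m = Negz k by lia.
  have -> : n = m - k.+2%:Z by lia.
  by rewrite [in RHS]/= KF.
Qed.

Lemma orbit_eq o1 o2 m : is_orbit o1 -> is_orbit o2 -> o1 m = o2 m ->
  forall n, o1 n = o2 n.
Proof.
move=> O1 O2 e; apply: (int_bidirectional_ind (m := m)) => // n.
  by rewrite O1 O2 => ->.
by rewrite O1 O2 => /(can_inj (FK n)).
Qed.

(** This is how identities between evolution maps are proved below: exhibit the
two sides as values of an orbit through the same point. *)
Lemma orbit_evolution o n m : is_orbit o -> evolution n m (o m) = o n.
Proof.
move=> O; apply: (orbit_eq (evolution_orbit m (o m)) O (m := m)).
by rewrite evolution_id.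
Qed.

Lemma evolutionA n m p x : evolution n m (evolution m p x) = evolution n p x.
Proof. exact: (orbit_evolution n m (evolution_orbit p x)). Qed.

Lemma evolution_stepr n m x : evolution n (m + 1) (F m x) = evolution n m x.
Proof.
by rewrite -(evolutionA n (m + 1) m x) evolution_orbit evolution_id.
Qed.

End Evolution.

Lemma continuous_evolution (T : topologicalType) (F Finv : int -> T -> T) n m :
  (forall k, continuous (F k)) -> (forall k, continuous (Finv k)) ->
  continuous (evolution F Finv n m).
Proof.
move=> cF cFinv; rewrite /evolution; case: (n - m) => k.
  elim: k => [|k IH] x /=; first exact: cvg_id.
  apply: (continuous_comp (g := F (m + k%:Z))); [exact: IH|exact: cF].
elim: k.+1 => [|j IH] x /=; first exact: cvg_id.
apply: (continuous_comp (g := Finv _)); [exact: IH|exact: cFinv].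
Qed.

(** * Evolution of a linear system *)
Section LinearEvolution.
Variables (R : realType) (X : normedModType R).
Variables (A : int -> {linear X -> X}) (Ainv : int -> X -> X).
Hypothesis AK : forall n, cancel (A n) (Ainv n).
Hypothesis KA : forall n, cancel (Ainv n) (A n).
Local Notation Phi := (evolution A Ainv).

Lemma evolution_comb n m (a : R) x y : Phi n m (a *: x + y) = a *: Phi n m x + Phi n m y.
Proof.
pose o n := a *: Phi n m x + Phi n m y.
have O : is_orbit A o by move=> k; rewrite /o !evolution_orbit // linearP.
have -> : a *: x + y = o m by rewrite /o !evolution_id.
by rewrite orbit_evolution.
Qed.

Lemma evolutionD n m x y : Phi n m (x + y) = Phi n m x + Phi n m y.
Proof. by have := evolution_comb n m 1 x y; rewrite !scale1r. Qed.

Lemma evolution0 n m : Phi n m 0 = 0.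
Proof. by apply: (addIr (Phi n m 0)); rewrite -evolutionD !add0r. Qed.

Lemma evolutionZ n m (a : R) x : Phi n m (a *: x) = a *: Phi n m x.
Proof. by have := evolution_comb n m a x 0; rewrite evolution0 !addr0. Qed.

Lemma linear_inverseB n x y : Ainv n (x - y) = Ainv n x - Ainv n y.
Proof. by apply: (can_inj (AK n)); rewrite linearB /= !KA. Qed.

Lemma linear_inverseZ n (a : R) x : Ainv n (a *: x) = a *: Ainv n x.
Proof. by apply: (can_inj (AK n)); rewrite linearZ /= !KA. Qed.

End LinearEvolution.

(** * Norm bounds *)
Lemma opnorm_le (R : realType) (X : normedModType R) (f : X -> X) (b : R) :
  (forall a x, f (a *: x) = a *: f x) -> (opnorm f <= b%:E)%E ->
  forall x, `|f x| <= b * `|x|.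
Proof.
move=> fZ fb x; have [->|x0] := eqVneq x 0.
  by rewrite -[X in f X](scale0r 0) fZ scale0r !normr0 mulr0.
have nx : 0 < `|x| by rewrite normr_gt0.
have -> : f x = `|x| *: f (`|x|^-1 *: x).
  by rewrite -fZ scalerA divff ?gt_eqF// scale1r.
rewrite normrZ normr_id mulrC ler_pM2r // -lee_fin.
apply: le_trans fb; apply: ereal_sup_ubound => /=.
exists (`|x|^-1 *: x) => //.
by rewrite normrZ normfV normr_id mulVf ?gt_eqF.
Qed.

Lemma lty_le_EFin (R : realType) (s : \bar R) :
  (s < +oo)%E -> exists2 b : R, 0 < b & (s <= b%:E)%E.
Proof.
case: s => [s _| |_] //; last by exists 1; rewrite ?leNye.
by exists (`|s| + 1); rewrite ?ltr_wpDl // lee_fin (le_trans (ler_norm s)) // lerDl.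
Qed.

Lemma supnorm_leP (R : realType) (X : normedModType R) (T : Type) (f : T -> X) (b : R) :
  (supnorm f <= b%:E)%E <-> forall t, `|f t| <= b.
Proof.
split=> [fb t|fb].
  by rewrite -lee_fin; apply: le_trans fb; apply: ereal_sup_ubound; exists t.
by apply: ge_ereal_sup => _ [t _ <-]; rewrite lee_fin.
Qed.

(** * Geometric sequences of increments and contractions *)
Lemma geometric_small (R : realType) (b q e : R) : 0 <= q < 1 -> 0 < e ->
  exists k : nat, b * q ^+ k <= e.
Proof.
move=> /andP[q0 q1] e0.
have /cvgr0Pnorm_le : geometric b q @ \oo --> 0.
  by apply: cvg_geometric; rewrite ger0_norm.
move=> /(_ _ e0)[k _ /(_ k (leqnn k))] /= h; exists k.
exact: le_trans (ler_norm _) h.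
Qed.

Lemma geometric_chain (R : realType) (X : normedModType R) (u : nat -> X)
    (b q : R) (N : nat) :
  0 <= q < 1 -> 0 <= b ->
  (forall k, (k < N)%N -> `|u k.+1 - u k| <= b * q ^+ k) ->
  `|u N - u 0%N| <= b / (1 - q).
Proof.
move=> /andP[q0 q1] b0 step.
have q1' : 0 < 1 - q by rewrite subr_gt0.
suff H : `|u N - u 0%N| <= b * (1 - q ^+ N) / (1 - q).
  apply: le_trans H _; rewrite ler_pM2r ?invr_gt0// ler_piMr//.
  by rewrite gerBl exprn_ge0.
elim: N step => [|N IH] step; first by rewrite subrr normr0 expr0 subrr mulr0 mul0r.
have -> : u N.+1 - u 0%N = (u N.+1 - u N) + (u N - u 0%N).
  by rewrite addrA subrK.
apply: le_trans (ler_normD _ _) _.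
have {}IH := IH (fun k kN => step k (ltnW kN)).
apply: le_trans (lerD (step N (leqnn _)) IH) _.
rewrite le_eqVlt; apply/orP; left; apply/eqP.
by rewrite exprS; field; rewrite gt_eqF.
Qed.

Lemma geometric_cvg (R : realType) (X : completeNormedModType R) (u : nat -> X)
    (b q : R) :
  0 <= q < 1 -> 0 <= b -> (forall k, `|u k.+1 - u k| <= b * q ^+ k) ->
  exists l : X, forall k, `|l - u k| <= b / (1 - q) * q ^+ k.
Proof.
move=> q01 b0 step; have /andP[q0 q1] := q01.
have tail k n : `|u (k + n)%N - u k| <= b / (1 - q) * q ^+ k.
  rewrite mulrAC -[X in _ - u X]addn0.
  apply: (geometric_chain (u := fun j => u (k + j)%N)) => //.
    by rewrite mulr_ge0 ?exprn_ge0.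
  by move=> j _; rewrite addnS -mulrA -exprD.
have cu : cvgn u.
  apply: cauchy_cvg; apply: cauchy_exP => e e0.
  have [k hk] := geometric_small (b / (1 - q)) q01 (divr_gt0 e0 (ltr0n _ 2)).
  exists (u k); suff: \forall n \near \oo, ball (u k) e (u n) by [].
  near=> n; rewrite -ball_normE /= distrC.
  have -> : n = (k + (n - k))%N by rewrite subnKC//; near: n; exact: nbhs_infty_ge.
  apply: le_lt_trans (tail _ _) _; apply: le_lt_trans hk _; lra.
exists (limn u) => k; apply/ler_addgt0Pr => e e0.
have /cvgrPdist_le /(_ _ e0) hlim := cu.
near \oo => n.
have -> : limn u - u k = (limn u - u n) + (u n - u k) by rewrite addrA subrK.
apply: le_trans (ler_normD _ _) _; rewrite addrC lerD//.
  have -> : n = (k + (n - k))%N by rewrite subnKC//; near: n; exact: nbhs_infty_ge.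
  exact: tail.
by near: n.
Unshelve. all: by end_near. Qed.

(** The contraction principle for families [I -> X] under the supremum distance,
which is allowed to take the value infinity: only the first increment has to be
finite.  Every iterate stays at finite distance from [u0], and the limit is taken
index by index, uniformly in the index. *)
Lemma sup_contraction_fixpoint (R : realType) (X : completeNormedModType R)
    (I : Type) (Phi : (I -> X) -> I -> X) (q M : R) (u0 : I -> X) :
  0 < q < 1 -> 0 < M ->
  (forall u v r, 0 < r -> (forall i, `|u i - v i| <= r) ->
    forall i, `|Phi u i - Phi v i| <= q * r) ->
  (forall i, `|Phi u0 i - u0 i| <= M) ->
  exists u, forall i, Phi u i = u i.
Proof.
move=> /andP[q0 q1] M0 contr hM.
have q01 : 0 <= q < 1 by rewrite ltW.
have step k i : `|iter k.+1 Phi u0 i - iter k Phi u0 i| <= M * q ^+ k.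
  elim: k i => [|k IH] i; first by rewrite expr0 mulr1.
  rewrite exprS mulrCA; apply: contr => //.
  by rewrite mulr_gt0 ?exprn_gt0.
have /choice[u hu] : forall i, exists l : X,
    forall k, `|l - iter k Phi u0 i| <= M / (1 - q) * q ^+ k.
  by move=> i; apply: (geometric_cvg q01 (ltW M0)) => k; exact: step.
exists u => i; apply/eqP; rewrite -subr_eq0 -normr_le0; apply/ler_addgt0Pr => e e0.
rewrite add0r.
have [k hk] := geometric_small (M / (1 - q)) q01 (divr_gt0 e0 (ltr0n _ 2)).
set rho := M / (1 - q) * q ^+ k in hk *.
have rho0 : 0 < rho by rewrite mulr_gt0 ?exprn_gt0// divr_gt0// subr_gt0.
have h1 := contr u (iter k Phi u0) rho rho0 (fun i => hu i k) i.
have h2 := hu i k.+1; rewrite exprS mulrCA -/rho in h2.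
have -> : Phi u i - u i = (Phi u i - iter k.+1 Phi u0 i) - (u i - iter k.+1 Phi u0 i).
  by rewrite opprB addrA subrK.
apply: le_trans (ler_normB _ _) _; apply: le_trans (lerD h1 h2) _.
have : q * rho <= rho by rewrite ler_piMl// ltW.
lra.
Qed.

(** * The dichotomy as estimates on the evolution *)

Section Hyperbolicity.
Variables (R : realType) (X : normedModType R).
Variables (A : int -> {linear X -> X}) (Ainv : int -> X -> X).
Hypothesis AK : forall n, cancel (A n) (Ainv n).
Hypothesis KA : forall n, cancel (Ainv n) (A n).
Local Notation Phi := (evolution A Ainv).

(** An exponential dichotomy whose backward bound is stated with the evolution of
the invertible system, so that no inverse on a kernel appears; [r] stands for
[exp (- lambda)]. *)
Definition hyperbolic (P : int -> {linear X -> X}) (C r : R) : Prop :=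
  [/\ 0 < C, 0 < r < 1,
      (forall n x, P (n + 1) (A n x) = A n (P n x)),
      (forall (n : int) (k : nat) x, `|Phi (n + k%:Z) n (P n x)| <= C * r ^+ k * `|x|) &
      (forall (n : int) (k : nat) x,
        `|Phi n (n + k%:Z) (x - P (n + k%:Z) x)| <= C * r ^+ k * `|x|)].

Lemma evolution_equivariant (P : int -> {linear X -> X}) :
  (forall m x, P (m + 1) (A m x) = A m (P m x)) ->
  forall n m x, P n (Phi n m x) = Phi n m (P m x).
Proof.
move=> PA n m x.
pose o k := P k (Phi k m x).
have O : is_orbit A o by move=> k; rewrite /o evolution_orbit // PA.
by rewrite -[LHS]/(o n) -(orbit_evolution AK KA n m O) /o evolution_id.
Qed.

Lemma cocycle_evolution (n : int) (k : nat) : cocycle A (n + k%:Z) n = Phi (n + k%:Z) n.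
Proof. by apply/funext => x; rewrite /cocycle /evolution addrAC subrr add0r. Qed.

(** The evolution [Phi n (n + k)] maps the kernel of the projection at [n + k] into
the kernel at [n] and inverts the cocycle, hence it coincides there with the
inverse used to define the backward cocycle. *)
Lemma exp_dichotomy_hyperbolic : exp_dichotomy A ->
  exists (P : int -> {linear X -> X}) (C r : R), hyperbolic P C r.
Proof.
move=> [P [C [lambda [PP PA _ [C0 l0 fwd bwd]]]]].
have rk (n : int) (k : nat) : expR (- lambda * (n + k%:Z - n)%:~R) = expR (- lambda) ^+ k.
  by rewrite addrAC subrr add0r -expRM_natr.
exists P, C, (expR (- lambda)); split=> //.
- by rewrite expR_gt0 -expR0 ltr_expR oppr_lt0.
- move=> n k x.
  apply: (opnorm_le (f := fun x => Phi (n + k%:Z) n (P n x))).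
    by move=> a y; rewrite linearZ /= evolutionZ.
  by rewrite -(rk n) -cocycle_evolution; apply: fwd; rewrite lerDl.
- move=> n k x.
  have backE y : back_cocycle A P n (n + k%:Z) (y - P (n + k%:Z) y) =
      Phi n (n + k%:Z) (y - P (n + k%:Z) y).
    set v := y - _.
    have -> : v = cocycle A (n + k%:Z) n (Phi n (n + k%:Z) v).
      by rewrite cocycle_evolution evolutionA // evolution_id.
    rewrite /back_cocycle pinvKV; first by rewrite cocycle_evolution !evolutionA// evolution_id.
      move=> a b _ _; rewrite cocycle_evolution.
      by move=> /(congr1 (Phi n (n + k%:Z))); rewrite !evolutionA // !evolution_id.
    rewrite inE /lker_set /= evolution_equivariant// /v linearB /= PP subrr.
    exact: evolution0.
  apply: (opnorm_le (f := fun x => Phi n (n + k%:Z) (x - P (n + k%:Z) x))).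
    by move=> a y; rewrite linearZ /= -scalerBr evolutionZ.
  rewrite -(rk n).
  have <- : (fun y => back_cocycle A P n (n + k%:Z) (y - P (n + k%:Z) y)) =
            (fun y => Phi n (n + k%:Z) (y - P (n + k%:Z) y)) by exact/funext.
  by apply: bwd; rewrite lerDl.
Qed.

Definition forced_solution (f w : int -> X) : Prop :=
  forall n, w (n + 1) = A n (w n) + f n.

Variables (P : int -> {linear X -> X}) (C r : R).
Hypothesis hyp : hyperbolic P C r.

(** Follow the stable component of [w] from time [m - N] to [m], and the unstable
component from [m + N] back to [m].  Transported to time [m] by the evolution,
each component changes by at most [C * eta * r ^+ k] at the [k]-th step away from
[m], and at the end of the window it is at most [C * r ^+ N * M]. *)
Lemma window_estimate (f w : int -> X) (M eta : R) (m : int) (N : nat) :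
  forced_solution f w -> 0 <= eta -> (forall n, `|w n| <= M) ->
  (forall n, m - N%:Z <= n <= m + N%:Z -> `|f n| <= eta) ->
  `|w m| <= 2 * (C * r ^+ N * M + C * eta / (1 - r)).
Proof.
move=> weq eta0 wM feta; have [C0 /andP[r0 r1] PA fwd bwd] := hyp.
have r01 : 0 <= r < 1 by rewrite ltW.
(* [a k] is a component of [w] at distance [k] from [m], transported to time [m]. *)
have half (a : nat -> X) : `|a N| <= C * r ^+ N * M ->
    (forall k, (k < N)%N -> `|a k.+1 - a k| <= C * eta * r ^+ k) ->
    `|a 0%N| <= C * r ^+ N * M + C * eta / (1 - r).
  move=> aN step.
  have -> : a 0%N = a N - (a N - a 0%N) by rewrite opprB addrC subrK.
  apply: le_trans (ler_normB _ _) _; apply: lerD => //.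
  by apply: geometric_chain; rewrite ?mulr_ge0// ltW.
have hP := half (fun k => Phi m (m - k%:Z) (P (m - k%:Z) (w (m - k%:Z)))).
have hQ := half (fun k => Phi m (m + k%:Z) (w (m + k%:Z) - P (m + k%:Z) (w (m + k%:Z)))).
have -> : w m = P m (w m) + (w m - P m (w m)) by rewrite addrC subrK.
apply: le_trans (ler_normD _ _) _; rewrite mulr2n mulrDl mul1r; apply: lerD.
  have -> : P m (w m) = Phi m (m - 0%:Z) (P (m - 0%:Z) (w (m - 0%:Z))).
    by rewrite subr0 evolution_id.
  have fwd' k y : `|Phi m (m - k%:Z) (P (m - k%:Z) y)| <= C * r ^+ k * `|y|.
    by have := fwd (m - k%:Z) k y; rewrite subrK.
  apply: hP => [|k kN].
    by apply: le_trans (fwd' _ _) _; rewrite ler_wpM2l// mulr_ge0 ?exprn_ge0 ?ltW.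
  rewrite distrC.
  have -> : m - k%:Z = m - k.+1%:Z + 1 by lia.
  set n := m - k.+1%:Z.
  rewrite weq linearD /= PA evolutionD // evolution_stepr // addrC addKr.
  have -> : n + 1 = m - k%:Z by rewrite /n; lia.
  apply: le_trans (fwd' _ _) _; rewrite mulrAC ler_wpM2r ?exprn_ge0 ?(ltW r0)//.
  by rewrite ler_wpM2l ?(ltW C0)// feta// /n; lia.
have -> : w m - P m (w m) =
    Phi m (m + 0%:Z) (w (m + 0%:Z) - P (m + 0%:Z) (w (m + 0%:Z))).
  by rewrite addr0 evolution_id.
apply: hQ => [|k kN].
  by apply: le_trans (bwd _ _ _) _; rewrite ler_wpM2l// mulr_ge0 ?exprn_ge0 ?ltW.
have e1 : m + k.+1%:Z = m + k%:Z + 1 by lia.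
set n := m + k%:Z in e1 *.
have -> : Phi m (m + k.+1%:Z) (w (m + k.+1%:Z) - P (m + k.+1%:Z) (w (m + k.+1%:Z)))
   - Phi m n (w n - P n (w n)) = Phi m (m + k.+1%:Z) (f n - P (m + k.+1%:Z) (f n)).
  rewrite e1 weq linearD /= PA opprD addrACA -linearB /= evolutionD//.
  by rewrite evolution_stepr// [LHS]addrC addKr.
apply: le_trans (bwd _ _ _) _.
have rS : C * r ^+ k.+1 <= C * r ^+ k.
  by rewrite ler_wpM2l ?(ltW C0)// ler_wiXn2l ?(ltW r0) ?(ltW r1).
have fn : `|f n| <= eta by apply: feta; rewrite /n; lia.
rewrite [leRHS]mulrAC; apply: ler_pM => //.
by rewrite mulr_ge0 ?exprn_ge0 ?ltW.
Qed.
End Hyperbolicity.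

(** * Solutions of the forced linear equation *)

Lemma near_int_window (S : Type) (F : set_system S) {FF : Filter F}
    (Q : int -> S -> Prop) (m : int) (N : nat) :
  (forall n, \forall s \near F, Q n s) ->
  \forall s \near F, forall n, m - N%:Z <= n <= m + N%:Z -> Q n s.
Proof.
move=> hQ.
have : \forall s \near F, forall i : 'I_(N + N).+1, Q (m - N%:Z + i%:Z) s.
  by apply: filter_forall => i; exact: hQ.
apply: filterS => s h n /andP[n1 n2].
have lt : (`|(n - (m - N%:Z))%R| < (N + N).+1)%N by lia.
have := h (Ordinal lt); rewrite /=.
by have -> : m - N%:Z + Posz `|(n - (m - N%:Z))%R| = n by lia.
Qed.

Section ForcedSolutions.
Variables (R : realType) (X : normedModType R).
Variables (A : int -> {linear X -> X}) (Ainv : int -> X -> X).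
Hypothesis AK : forall n, cancel (A n) (Ainv n).
Hypothesis KA : forall n, cancel (Ainv n) (A n).
Variables (P : int -> {linear X -> X}) (C r : R).
Hypothesis hyp : hyperbolic A Ainv P C r.

(** If the solutions are eventually at most [Mj] at each time, then on a large
window the forcing is eventually at most [2 * kappa * Mj]; the window estimate
and the smallness of [kappa] then give the bound [Mj / 2] at each time.  The
window, hence the set of parameters [s], depends on [j], but finitely many
halvings reach any prescribed [e]. *)
Lemma forced_solution_vanishing (S : Type) (F : set_system S) {FF : Filter F}
    (f w : S -> int -> X) (M kappa : R) :
  0 < M -> 0 < kappa -> 16 * C * kappa <= 1 - r ->
  (forall s, forced_solution A (f s) (w s)) ->
  (forall s n, `|w s n| <= M) ->
  (forall n (e : R), 0 < e -> \forall s \near F, `|f s n| <= kappa * `|w s n| + e) ->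
  forall n (e : R), 0 < e -> \forall s \near F, `|w s n| <= e.
Proof.
move=> M0 k0 small weq wM fsmall; have [C0 /andP[r0 r1] _ _ _] := hyp.
have r1' : 0 < 1 - r by rewrite subr_gt0.
suff H j : forall n, \forall s \near F, `|w s n| <= M * 2^-1 ^+ j.
  move=> n e e0; have [|j hj] := geometric_small M (q := 2^-1) _ e0; first by lra.
  by apply: filterS (H j n) => s /le_trans; apply.
elim: j => [|j IH] n.
  by apply: filterE => s; rewrite expr0 mulr1.
set Mj := M * 2^-1 ^+ j in IH.
have Mj0 : 0 < Mj by rewrite mulr_gt0// exprn_gt0// invr_gt0.
have r01 : 0 <= r < 1 by rewrite ltW.
have [N hN] := geometric_small (C * M) r01 (divr_gt0 Mj0 (ltr0n _ 16)).
have near_f k : \forall s \near F, `|f s k| <= 2 * kappa * Mj.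
  apply: filterS2 (IH k) (fsmall k _ (mulr_gt0 k0 Mj0)) => s h1 h2.
  have : kappa * `|w s k| <= kappa * Mj by rewrite ler_wpM2l// ltW.
  by move: h2; lra.
apply: filterS (near_int_window n N near_f) => s hs.
have eta0 : 0 <= 2 * kappa * Mj by rewrite !mulr_ge0// ltW.
apply: le_trans (window_estimate AK KA hyp (weq s) eta0 (wM s) hs) _.
rewrite exprSr [leRHS]mulrA -/Mj.
have -> : C * r ^+ N * M = C * M * r ^+ N by rewrite mulrAC.
(* With [Mj / 16] from the far ends of the window, the total is [3 * Mj / 8]. *)
have : C * (2 * kappa * Mj) / (1 - r) <= Mj / 8.
  rewrite ler_pdivrMr// -subr_ge0.
  have -> : Mj / 8 * (1 - r) - C * (2 * kappa * Mj) = Mj / 8 * (1 - r - 16 * C * kappa).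
    by field.
  by rewrite mulr_ge0 ?divr_ge0 ?subr_ge0// ltW.
move: hN Mj0; move: (C * M * r ^+ N) (C * _ / _) => a b; lra.
Qed.

Lemma forced_solution_zero (f w : int -> X) (M kappa : R) :
  0 < kappa -> 16 * C * kappa <= 1 - r ->
  forced_solution A f w -> (forall n, `|w n| <= M) ->
  (forall n, `|f n| <= kappa * `|w n|) -> forall n, w n = 0.
Proof.
move=> k0 small weq wM fw n.
apply/eqP; rewrite -normr_le0; apply/ler_addgt0Pr => e e0; rewrite add0r.
have M0 : 0 < M + 1 by rewrite ltr_wpDl// (le_trans _ (wM 0)).
suff H : \forall s \near globally [set: unit], `|w n| <= e by exact: (H tt I).
apply: (forced_solution_vanishing (f := fun=> f) (w := fun=> w) M0 k0 small) => //.
- by move=> _ k; apply: le_trans (wM k) _; rewrite lerDl.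
- by move=> k e1 e10 _ _; apply: le_trans (fw k) _; rewrite lerDl ltW.
Qed.

Variable L : R.
Hypothesis shadow : lipschitz_shadowing A L.

(** A solution of the forced equation is a pseudo-orbit of the linear system whose
error is the forcing; subtracting an orbit that shadows it gives a bounded
solution. *)
Lemma bounded_forced_solution (f : int -> X) (e : R) :
  0 < e -> (forall n, `|f n| <= L * e) ->
  exists w, forced_solution A f w /\ forall n, `|w n| <= e.
Proof.
move=> e0 fe.
pose y n := evolution (fun n x => A n x + f n) (fun n x => Ainv n (x - f n)) n 0 0.
have yO : is_orbit (fun n x => A n x + f n) y.
  by apply: evolution_orbit => n x; rewrite KA subrK.
have [|x [xO xy]] := shadow (y := y) e0.
  by apply/supnorm_leP => n; rewrite yO addrC addKr.
exists (fun n => y n - x n); split => n.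
  by rewrite yO xO linearB /= addrAC.
by rewrite distrC; move/supnorm_leP: xy; apply.
Qed.

End ForcedSolutions.

(** * Near-identity semiconjugacies between perturbations *)

Lemma subrACA (V : zmodType) (x y z t : V) : (x - y) - (z - t) = (x - z) - (y - t).
Proof. by rewrite !opprD addrACA. Qed.

Lemma lipschitz_bound_continuous (R : realType) (X Y : normedModType R)
    (f : X -> Y) (k : R) :
  0 < k -> (forall x y, `|f x - f y| <= k * `|x - y|) -> continuous f.
Proof.
move=> k0 fk x; apply/cvgrPdist_le => e e0.
have ek : 0 < e / k by rewrite divr_gt0.
have /cvgrPdist_le /(_ _ ek) near_x := @cvg_id _ (nbhs x).
near=> y; apply: le_trans (fk x y) _; rewrite -ler_pdivlMl// mulrC.
by near: y.
Unshelve. all: by end_near. Qed.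

Definition perturb (R : realType) (X : normedModType R)
  (A : int -> X -> X) (g : int -> X -> X) (n : int) (x : X) : X := A n x + g n x.

Definition near_id_semiconj (R : realType) (X : normedModType R)
    (F F' : int -> X -> X) (e : R) (H : int -> X -> X) : Prop :=
  (forall n x, H (n + 1) (F n x) = F' n (H n x)) /\
  (forall n x, `|H n x - x| <= e).

Section Perturbation.
Variables (R : realType) (X : completeNormedModType R).
Variables (A : int -> {linear X -> X}) (Ainv : int -> X -> X).
Hypothesis AK : forall n, cancel (A n) (Ainv n).
Hypothesis KA : forall n, cancel (Ainv n) (A n).
Variables (P : int -> {linear X -> X}) (C r : R).
Hypothesis hyp : hyperbolic A Ainv P C r.
Variable L : R.
Hypothesis L0 : 0 < L.
Hypothesis shadow : lipschitz_shadowing A L.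
Variable c : R.
Hypothesis c0 : 0 < c.
Hypothesis cL : c < L.
Hypothesis small : 16 * C * c <= 1 - r.

Definition equilipschitz (g : int -> X -> X) : Prop :=
  forall n x y, `|g n x - g n y| <= c * `|x - y|.

(** Solving [A n x + g n x = y] for [x] is the fixed point problem
[x = Ainv n (y - g n x)], of contraction factor [k * c].  It is solved for all
[n] and [y] at once, as a single fixed point over the index type [int * X]. *)
Lemma perturb_inverse (g : int -> X -> X) (b k : R) :
  equilipschitz g -> (forall n x, `|g n x| <= b) ->
  0 < k -> (forall n x, `|Ainv n x| <= k * `|x|) -> k * c < 1 ->
  exists Ginv : int -> X -> X,
    [/\ forall n, cancel (perturb A g n) (Ginv n),
        forall n, cancel (Ginv n) (perturb A g n) &
        forall n, continuous (Ginv n)].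
Proof.
move=> gc gb k0 Ak kc.
(* Also the source of the Lipschitz bound of the inverse. *)
have contract n x x' y y' : `|Ainv n (y - g n x) - Ainv n (y' - g n x')|
    <= k * `|y - y'| + k * c * `|x - x'|.
  rewrite -(linear_inverseB AK KA); apply: le_trans (Ak _ _) _.
  rewrite -mulrA -mulrDr ler_pM2l//.
  have -> : y - g n x - (y' - g n x') = (y - y') + (g n x' - g n x).
    by rewrite subrACA opprB.
  by apply: le_trans (ler_normD _ _) _; rewrite lerD2l distrC.
pose Phi (u : int * X -> X) (ny : int * X) := Ainv ny.1 (ny.2 - g ny.1 (u ny)).
have [||||u hu] := @sup_contraction_fixpoint R X _ Phi (k * c) (k * (`|b| + 1))
    (fun ny => Ainv ny.1 ny.2).
- by rewrite mulr_gt0.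
- by rewrite mulr_gt0// ltr_wpDl.
- move=> u v d d0 uv [n y]; apply: le_trans (contract _ _ _ _ _) _.
  by rewrite subrr normr0 mulr0 add0r ler_wpM2l// ltW// mulr_gt0.
- move=> [n y]; rewrite /Phi -(linear_inverseB AK KA) /= addrAC subrr add0r.
  apply: le_trans (Ak _ _) _; rewrite ler_pM2l// normrN.
  by apply: le_trans (gb _ _) _; rewrite (le_trans (ler_norm b))// lerDl.
have sol n y : Ainv n (y - g n (u (n, y))) = u (n, y) by rewrite -[RHS]hu.
have kc1 : 0 < 1 - k * c by rewrite subr_gt0.
have lip n x x' y y' : x = Ainv n (y - g n x) -> x' = Ainv n (y' - g n x') ->
    `|x - x'| <= k / (1 - k * c) * `|y - y'|.
  move=> ex ex'; have := contract n x x' y y'; rewrite -ex -ex' => h.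
  by rewrite mulrAC ler_pdivlMr// mulrBr mulr1 lerBlDr [_ * (k * c)]mulrC.
exists (fun n y => u (n, y)); split=> n.
- move=> x; apply/eqP; rewrite -subr_eq0 -normr_le0.
  have := lip n (u (n, perturb A g n x)) x (perturb A g n x) (perturb A g n x).
  by rewrite subrr normr0 mulr0; apply; rewrite ?sol// /perturb addrK AK.
- by move=> y; rewrite /perturb -{1}sol KA subrK.
- apply: (@lipschitz_bound_continuous _ _ _ _ (k / (1 - k * c))).
    by rewrite divr_gt0.
  by move=> y y'; apply: (lip n); rewrite sol.
Qed.

Lemma perturb_continuous (g : int -> X -> X) n :
  equilipschitz g -> continuous (A n) -> continuous (perturb A g n).
Proof.
move=> gc cA x; apply: cvgD; first exact: cA.
exact: (lipschitz_bound_continuous c0 (gc n)).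
Qed.

Lemma perturb_diff_forced (g g' : int -> X -> X) (y y' : int -> X) :
  is_orbit (perturb A g) y -> is_orbit (perturb A g') y' ->
  forced_solution A (fun n => g' n (y' n) - g n (y n)) (fun n => y' n - y n).
Proof.
by move=> O O' n; rewrite O O' /perturb linearB /= opprD addrACA.
Qed.

(** The difference of two orbits solves the linear equation with a forcing at most
[c] times itself, so if it is bounded it vanishes. *)
Lemma perturb_orbit_unique (g : int -> X -> X) (M : R) (y y' : int -> X) :
  equilipschitz g -> is_orbit (perturb A g) y -> is_orbit (perturb A g) y' ->
  (forall n, `|y' n - y n| <= M) -> forall n, y' n = y n.
Proof.
move=> gc O O' yM n; apply/eqP; rewrite -subr_eq0; apply/eqP.
apply: (forced_solution_zero AK KA hyp c0 small (perturb_diff_forced O O') yM).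
by move=> k; exact: gc.
Qed.

Lemma forced_solutionB (f f' w w' : int -> X) :
  forced_solution A f w -> forced_solution A f' w' ->
  forced_solution A (fun n => f n - f' n) (fun n => w n - w' n).
Proof. by move=> weq weq' n; rewrite weq weq' linearB /= opprD addrACA. Qed.

(** The images of an orbit of [F] under two near-identity semiconjugacies are
orbits at bounded distance from each other. *)
Lemma near_id_semiconj_unique (F Finv g' : int -> X -> X) (e e' : R) H H' :
  (forall n, cancel (Finv n) (F n)) -> equilipschitz g' ->
  near_id_semiconj F (perturb A g') e H -> near_id_semiconj F (perturb A g') e' H' ->
  H = H'.
Proof.
move=> KF gc [HF He] [HF' He']; apply/funext => m; apply/funext => x.
pose y n := evolution F Finv n m x.
have O : is_orbit F y by exact: evolution_orbit.
have -> : x = y m by rewrite /y evolution_id.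
apply: (@perturb_orbit_unique g' (e + e') (fun n => H' n (y n)) (fun n => H n (y n))) => // n.
- by rewrite O HF'.
- by rewrite O HF.
- have -> : H n (y n) - H' n (y n) = (H n (y n) - y n) - (H' n (y n) - y n).
    by rewrite opprB addrA subrK.
  by apply: le_trans (ler_normB _ _) _; rewrite lerD.
Qed.

Lemma near_id_semiconj_comp (F F' F'' : int -> X -> X) (e e' : R) H H' :
  near_id_semiconj F F' e H -> near_id_semiconj F' F'' e' H' ->
  near_id_semiconj F F'' (e' + e) (fun n => H' n \o H n).
Proof.
move=> [HF He] [HF' He']; split=> n x /=; first by rewrite HF HF'.
have -> : H' n (H n x) - x = (H' n (H n x) - H n x) + (H n x - x).
  by rewrite addrA subrK.
by apply: le_trans (ler_normD _ _) _; rewrite lerD.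
Qed.

Lemma near_id_semiconj_id (F : int -> X -> X) : near_id_semiconj F F 0 (fun=> id).
Proof. by split=> // n x; rewrite subrr normr0. Qed.

(** The difference [z] between the orbits is a fixed point of the map [Phi] that
sends [z] to a bounded solution with forcing [g' n (y n + z n) - g n (y n)].
Bounded solutions are unique, so the difference [Phi u - Phi v] is the solution
which [bounded_forced_solution] provides for the difference of the forcings; this
gives the contraction factor [c / L]. *)
Lemma perturb_orbit_shadow (g g' : int -> X -> X) (e : R) (y : int -> X) :
  0 < e -> equilipschitz g' -> (forall n x x', `|g' n x' - g n x| <= L * e) ->
  is_orbit (perturb A g) y ->
  exists y', is_orbit (perturb A g') y' /\ forall n, `|y' n - y n| <= e.
Proof.
move=> e0 gc ge O.
pose f (z : int -> X) n := g' n (y n + z n) - g n (y n).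
have /choice[Phi hPhi] : forall z, exists w,
    forced_solution A (f z) w /\ forall n, `|w n| <= e.
  by move=> z; apply: (bounded_forced_solution KA shadow (f := f z) e0) => n; exact: ge.
have [||||z hz] := @sup_contraction_fixpoint R X _ Phi (c / L) e (fun=> 0).
- by rewrite divr_gt0//= ltr_pdivrMr// mul1r.
- exact: e0.
- move=> u v d d0 uv.
  have [||w [weq we]] := bounded_forced_solution KA shadow
      (f := fun n => f u n - f v n) (e := c / L * d).
  + by rewrite mulr_gt0// divr_gt0.
  + move=> n; rewrite /f opprB addrA subrK; apply: le_trans (gc _ _ _) _.
    rewrite mulrA [L * _]mulrC divfK ?gt_eqF// ler_pM2l//.
    by rewrite opprD addrACA subrr add0r.
  have [[ueq ue] [veq ve]] := (hPhi u, hPhi v).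
  pose q n := Phi u n - Phi v n - w n.
  have q0 : forall n, q n = 0.
    apply: (forced_solution_zero AK KA hyp c0 small (M := e + e + c / L * d)
      (forced_solutionB (forced_solutionB ueq veq) weq)) => n.
    * apply: le_trans (ler_normB _ _) _; apply: lerD => //.
      by apply: le_trans (ler_normB _ _) _; rewrite lerD.
    * by rewrite subrr normr0 mulr_ge0// ltW.
  by move=> n; move/eqP: (q0 n); rewrite subr_eq0 => /eqP ->.
- by move=> n; rewrite subr0; case: (hPhi (fun=> 0)).
have [zeq ze] := hPhi z.
exists (fun n => y n + z n); split=> n.
  by rewrite -!hz zeq O /perturb linearD /= hz /f; rewrite addrACA [X in _ + X = _]addrC subrK.
by rewrite addrC addKr -hz.
Qed.

(** Sending each point to the present position of the [A + g']-orbit that stays near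
its [A + g]-orbit gives a semiconjugacy, because such orbits are unique.  It is
continuous: when [s] tends to [x], the orbit of [s] tends to that of [x] at each
fixed time, so the displacements [Z - Y] of the two orbits differ by a bounded
solution whose forcing is at most [c] times itself up to a vanishing error. *)
Lemma near_id_semiconj_exists (g g' Ginv : int -> X -> X) (e : R) :
  0 < e -> equilipschitz g -> equilipschitz g' ->
  (forall n x x', `|g' n x' - g n x| <= L * e) ->
  (forall n, cancel (perturb A g n) (Ginv n)) ->
  (forall n, cancel (Ginv n) (perturb A g n)) ->
  (forall n, continuous (perturb A g n)) -> (forall n, continuous (Ginv n)) ->
  exists H, near_id_semiconj (perturb A g) (perturb A g') e H /\
    forall n, continuous (H n).
Proof.
move=> e0 gc gc' ge GK KG cG cGinv.
pose Y n m x := evolution (perturb A g) Ginv n m x.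
have YO m x : is_orbit (perturb A g) (fun n => Y n m x).
  exact: evolution_orbit.
have /choice[Z hZ] : forall p : int * X, exists z, is_orbit (perturb A g') z /\
    forall n, `|z n - Y n p.1 p.2| <= e.
  by move=> [m x]; exact: (perturb_orbit_shadow e0 gc' ge (YO m x)).
have ZO m x : is_orbit (perturb A g') (Z (m, x)) by case: (hZ (m, x)).
have ZY m x n : `|Z (m, x) n - Y n m x| <= e by case: (hZ (m, x)).
exists (fun m x => Z (m, x) m); split; first split.
- move=> m x /=.
  rewrite -ZO; apply: (perturb_orbit_unique gc' (ZO m x) (ZO _ _) (M := e + e)) => n.
  have -> : Z (m + 1, perturb A g m x) n - Z (m, x) n =
      (Z (m + 1, perturb A g m x) n - Y n m x) - (Z (m, x) n - Y n m x).
    by rewrite opprB addrA subrK.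
  apply: le_trans (ler_normB _ _) _; rewrite lerD//.
  by have := ZY (m + 1) (perturb A g m x) n; rewrite /Y evolution_stepr.
- by move=> m x; have := ZY m x m; rewrite /Y evolution_id.
move=> m x; apply/cvgrPdist_le => d d0.
pose w s n := (Z (m, s) n - Y n m s) - (Z (m, x) n - Y n m x).
pose f s n := (g' n (Z (m, s) n) - g n (Y n m s)) - (g' n (Z (m, x) n) - g n (Y n m x)).
have weq s : forced_solution A (f s) (w s).
  by apply: forced_solutionB; exact: perturb_diff_forced.
have we s n : `|w s n| <= e + e.
  by apply: le_trans (ler_normB _ _) _; rewrite lerD.
have d2 : 0 < d / 2 by rewrite divr_gt0.
have near_w : \forall s \near x, `|w s m| <= d / 2.
  apply: (forced_solution_vanishing AK KA hyp (addr_gt0 e0 e0) c0 small weq we) => // n a a0.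
  have a2 : 0 < a / (2 * c) by rewrite divr_gt0// mulr_gt0.
  have cY : continuous (fun s => Y n m s) by exact: continuous_evolution.
  have /cvgrPdist_le /(_ _ a2) := cY x.
  apply: filterS => s; rewrite ler_pdivlMr ?mulr_gt0// distrC => hY.
  set dY := Y n m s - Y n m x in hY.
  have fE : f s n = (g' n (Z (m, s) n) - g' n (Z (m, x) n)) - (g n (Y n m s) - g n (Y n m x)).
    by rewrite /f subrACA.
  have wE : Z (m, s) n - Z (m, x) n = w s n + dY.
    by rewrite /w /dY subrACA subrK.
  rewrite fE; apply: le_trans (ler_normB _ _) _.
  apply: le_trans (lerD (gc' _ _ _) (gc _ _ _)) _; rewrite wE -/dY.
  have : c * `|w s n + dY| <= c * `|w s n| + c * `|dY|.
    by rewrite -mulrDr ler_pM2l// ler_normD.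
  by move: hY; lra.
have /cvgrPdist_le /(_ _ d2) near_x := @cvg_id _ (nbhs x).
apply: filterS2 near_w near_x => s h1 h2.
rewrite distrC.
have -> : Z (m, s) m - Z (m, x) m = w s m - (x - s).
  by rewrite -(opprB s) opprK /w /Y !evolution_id subrACA subrK.
apply: le_trans (ler_normB _ _) _.
by rewrite [d]splitr lerD.
Qed.
End Perturbation.

(** * The theorem *)

Theorem theorem7 (R : realType) (X : completeNormedModType R)
    (A : int -> {linear X -> X}) (Ainv : int -> X -> X) (L : R)
    (hA : forall m, (opnorm (A m) < +oo)%E)
    (hAK : forall m, cancel (A m) (Ainv m))
    (hKA : forall m, cancel (Ainv m) (A m))
    (hdich : exp_dichotomy A)
    (hAinv : (ereal_sup (range (fun m : int => opnorm (Ainv m))) < +oo)%E)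
    (hL : 0 < L)
    (hshadow : lipschitz_shadowing A L) :
  exists eps0 c0 : R, [/\ 0 < eps0, 0 < c0 &
    forall eps c delta : R,
      0 < eps -> eps < eps0 -> 0 < c -> c < c0 -> delta = L * eps ->
      forall g : int -> X -> X,
        (forall n x y, `|g n x - g n y| <= c * `|x - y|) ->
        (forall n, (supnorm (g n) <= delta%:E)%E) ->
        let G := fun n x => A n x + g n x in
        exists! h : int -> X -> X,
          (forall m, homeomorphism (h m)) /\
          (forall m, h (m + 1) \o G m = A m \o h m /\
             (supnorm (fun x => (h m x - x)%R) <= eps%:E)%E)].
Proof.
have [P [C [r hyp]]] := exp_dichotomy_hyperbolic hAK hKA hdich.
have [C0 /andP[_ r1] _ _ _] := hyp.
have [k k0 hk] := lty_le_EFin hAinv.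
have Aik n x : `|Ainv n x| <= k * `|x|.
  apply: opnorm_le => [a y|]; first exact: linear_inverseZ.
  by apply: le_trans hk; apply: ereal_sup_ubound; exists n.
have cA n : continuous (A n).
  have [b b0 hb] := lty_le_EFin (hA n).
  apply: (lipschitz_bound_continuous b0) => x y; rewrite -linearB.
  by apply: opnorm_le => // a z; rewrite linearZ.
(* The bounds on [c]: [c < L] to contract, [16 * C * c < 1 - r] for the
   vanishing of bounded solutions, [k * c < 1] to invert [A n + g n]. *)
exists 1, (Num.min L (Num.min ((1 - r) / (16 * C)) k^-1)); split=> //.
  by rewrite !lt_min hL invr_gt0 k0 divr_gt0 ?subr_gt0 ?mulr_gt0.
move=> e c delta e0 _ c0; rewrite !lt_min => /and3P[cL].
rewrite ltr_pdivlMr ?mulr_gt0// mulrC => /ltW small.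
rewrite -[k^-1]mul1r ltr_pdivlMr// mulrC => kc -> g gc gb G.
have {}gb n x : `|g n x| <= L * e by move/supnorm_leP: (gb n); apply.
pose g0 (_ : int) (_ : X) : X := 0.
have g0c : equilipschitz c g0 by move=> n x y; rewrite subrr normr0 mulr_ge0 ?(ltW c0).
have AE : perturb A g0 = (fun n => A n).
  by apply/funext => n; apply/funext => x; rewrite /perturb addr0.
have [Ginv [GK KG cGinv]] := perturb_inverse hAK hKA c0 gc gb k0 Aik kc.
have cAinv n : continuous (Ainv n).
  apply: (lipschitz_bound_continuous k0) => x y.
  by rewrite -(linear_inverseB hAK hKA).
have cG n : continuous (perturb A g n) by apply: (perturb_continuous c0) => //; exact: cA.
have gg0b n x x' : `|g0 n x' - g n x| <= L * e by rewrite sub0r normrN.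
have [h [hsemi hcont]] :=
  near_id_semiconj_exists hAK hKA hyp hL hshadow c0 cL small e0 gc g0c gg0b GK KG cG cGinv.
have g0gb n x x' : `|g n x' - g0 n x| <= L * e by rewrite subr0.
have [k' [ksemi kcont]] : exists H,
    near_id_semiconj (perturb A g0) (perturb A g) e H /\ forall n, continuous (H n).
  by apply: (near_id_semiconj_exists (Ginv := Ainv) hAK hKA hyp hL hshadow c0 cL small e0);
    rewrite // AE.
have hk' := near_id_semiconj_comp hsemi ksemi.
have k'h := near_id_semiconj_comp ksemi hsemi.
have k'hE := near_id_semiconj_unique hAK hKA hyp c0 small KG gc hk' (near_id_semiconj_id _).
have hk'E : (fun n => h n \o k' n) = (fun=> id).
  apply: (near_id_semiconj_unique hAK hKA hyp c0 small (Finv := Ainv) _ g0c k'h (near_id_semiconj_id _)).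
  by rewrite AE.
exists h; split.
  split=> m.
    split; first exact: hcont.
    exists (k' m); split; last exact: kcont.
      by move=> x; exact: (congr1 (fun H => H m x) k'hE).
    by move=> x; exact: (congr1 (fun H => H m x) hk'E).
  case: hsemi => hF he; split; last by apply/supnorm_leP.
  by apply/funext => x; rewrite /comp /G hF AE.
move=> h' [_ h'P].
apply: (near_id_semiconj_unique hAK hKA hyp c0 small KG g0c hsemi (e' := e)).
split=> n x; last by have [_ /supnorm_leP] := h'P n; apply.
by rewrite AE; have [/(congr1 (@^~ x))] := h'P n.
Qed.
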